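(* Let $(M,h)$ be a semi-Riemannian Einstein Spin-manifold with $\dim(M)=n$, i.e., $Ric(h)=2(n-1)\lambda h$ with $\lambda\in\mathbb{R}$. Let $g_+=r^{-2}(dr^2+h_r)$, $h_r=(1-\frac{J}{2n}r^2)^2h$, be the associated Poincaré-Einstein metric on $X=M\times(0,\varepsilon)$. Let $D^h$ be the Dirac operator of $(M,h)$ and $D^{h,h_r}=\beta_r^{-1}\circ D^{h_r}\circ\beta_r$ the Dirac operator of $(M,h_r)$ pulled back to $\Gamma(S(M,h))$. Then, for all $l\in\mathbb{N}_0$ and all $\psi\in\Gamma(S(M,h))$, $$\frac{d^{2l}}{dr^{2l}}\big(D^{h,h_r}\psi\big)\Big|_{r=0}=(2l)!\Big(\frac{J}{2n}\Big)^l D^h\psi,\qquad \frac{d^{2l+1}}{dr^{2l+1}}\big(D^{h,h_r}\psi\big)\Big|_{r=0}=0 .$$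
   Context: $\mathbb{N}_0=\{0,1,2,\dots\}$; $n=p+q\ge3$ where $(p,q)$ is the signature of $h$; $J=\frac{\tau}{2(n-1)}$ with $\tau$ the scalar curvature of $h$ (so $J=n\lambda$ is constant). Throughout $r\ge0$ is small enough that $1-\frac{J}{2n}r^2>0$. Clifford multiplication satisfies $x\cdot y+y\cdot x=-2\langle x,y\rangle$. Define $f_r:TM\to TM$ by $f_rY=(1-\frac{J}{2n}r^2)^{-1}Y$; it satisfies $h(Y,U)=h_r(f_rY,f_rU)$ and $f_0=\mathrm{Id}$. Being an isometry $(T_xM,h)\to(T_xM,h_r)$ it maps $h$-orthonormal frames to $h_r$-orthonormal frames and lifts to a vector bundle isomorphism of spinor bundles $\beta_r:S(M,h)\to S(M,h_r)$ covering the identity of $M$, with $\beta_0=\mathrm{Id}$ and $\beta_r(U\cdot\psi)=f_r(U)\cdot\beta_r(\psi)$ for $U\in\Gamma(TM)$, $\psi\in\Gamma(S(M,h))$. Here $S(M,h)$, $S(M,h_r)$ are the spinor bundles for the corresponding spin structures, and $D^h$, $D^{h_r}$ are the Dirac operators, $D^h\psi=\sum_i\varepsilon_is_i\cdot\nabla^{h,S}_{s_i}\psi$ for an $h$-orthonormal frame $\{s_i\}$ with $\varepsilon_i=h(s_i,s_i)=\pm1$ and $\nabla^{h,S}$ the spinor connection induced by the Levi-Civita connection (similarly for $h_r$). *)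

(* Defs.v *)
From HB Require Import structures.
From mathcomp Require Import all_boot all_order all_algebra.
From mathcomp Require Import complex.
From mathcomp Require Import all_classical all_reals all_analysis.

Set Implicit Arguments.
Unset Strict Implicit.
Unset Printing Implicit Defensive.

Import Order.TTheory GRing.Theory Num.Theory.
Import numFieldNormedType.Exports.

Local Open Scope classical_set_scope.
Local Open Scope complex_scope.
Local Open Scope ring_scope.

Section EuclideanCalculus.
Variables (R : realType) (n : nat).

(* Meant for open W only. *)
Fixpoint Cn (k : nat) (W : set 'rV[R]_n) (f : 'rV[R]_n -> R) : Prop :=
  (forall p, W p -> {for p, continuous f}) /\
  if k is k'.+1 then
    forall i : 'I_n, (forall p, W p -> derivable f p 'e_i) /\
                     Cn k' W (fun p => 'D_'e_i f p)
  else True.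

Definition Cinfty (W : set 'rV[R]_n) (f : 'rV[R]_n -> R) : Prop :=
  forall k, Cn k W f.

End EuclideanCalculus.

(* [chart_at x] is an arbitrary choice of a chart around x.  As in Lean's
   mathlib, T_x M is identified with R^n (row vectors) through that chart; no
   continuity of [chart_at] in x is required. *)
Record manifold (R : realType) (n : nat) := Manifold {
  carrier :> topologicalType;
  chart : Type;
  dom : chart -> set carrier;
  coor : chart -> carrier -> 'rV[R]_n;
  point : chart -> 'rV[R]_n -> carrier;
  chart_at : carrier -> chart;
  carrier_hausdorff : hausdorff_space carrier;
  carrier_second_countable : @second_countable carrier;
  dom_open : forall c, open (dom c);
  dom_chart_at : forall x, dom (chart_at x) x;
  coor_open : forall c, open (coor c @` dom c);
  coorK : forall c x, dom c x -> point c (coor c x) = x;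
  coor_continuous : forall c x, dom c x -> {for x, continuous (coor c)};
  point_continuous : forall c p, (coor c @` dom c) p ->
    {for p, continuous (point c)};
  transition_smooth : forall c d (j : 'I_n),
    Cinfty (coor c @` (dom c `&` dom d)) (fun p => coor d (point c p) 0 j)
}.

Section Geometry.
Variables (R : realType) (n : nat) (M : manifold R n).

Definition smooth_on (U : set M) (f : M -> R) : Prop :=
  forall c, Cinfty (coor c @` (dom c `&` U)) (f \o point c).

(* Row-vector convention: v *m change c d x are the coordinates in the chart d
   of the tangent vector at x with coordinates v in the chart c. *)
Definition change (c d : chart M) (x : M) : 'M[R]_n :=
  jacobian (coor d \o point c) (coor c x).

(* Y x : coordinates of the vector field in [chart_at x]; vec_in c Y p : its
   coordinates in the fixed chart c, at the point with coordinates p. *)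
Definition vec_in (c : chart M) (Y : M -> 'rV[R]_n) (p : 'rV[R]_n) : 'rV[R]_n :=
  let x := point c p in Y x *m change (chart_at x) c x.

Definition smooth_vector_field_on (U : set M) (Y : M -> 'rV[R]_n) : Prop :=
  forall c (j : 'I_n),
    Cinfty (coor c @` (dom c `&` U)) (fun p => vec_in c Y p 0 j).

(* h x : Gram matrix, in [chart_at x], of the bilinear form on T_x M;
   metric_in c h p : the components g_ij of h in the fixed chart c. *)
Definition metric_in (c : chart M) (h : M -> 'M[R]_n) (p : 'rV[R]_n) :
    'M[R]_n :=
  let x := point c p in
  let T := change c (chart_at x) x in T *m h x *m T^T.

Definition inner (h : M -> 'M[R]_n) (x : M) (u v : 'rV[R]_n) : R :=
  (u *m h x *m v^T) 0 0.

(* Signature (p, n - p), with p counting the negative directions. *)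
Definition eps (p : nat) (i : 'I_n) : R := if (i < p)%N then -1 else 1.

Definition epsmx (p : nat) : 'M[R]_n := diag_mx (\row_i eps p i).

Definition semi_riemannian_metric (p : nat) (h : M -> 'M[R]_n) : Prop :=
  [/\ forall x, (h x)^T = h x,
      forall x, exists2 P : 'M[R]_n,
        P \in unitmx & P *m h x *m P^T = epsmx p
    & forall c (i j : 'I_n),
        Cinfty (coor c @` dom c) (fun q => metric_in c h q i j)].

Definition christoffel (h : M -> 'M[R]_n) (c : chart M)
    (k i j : 'I_n) (p : 'rV[R]_n) : R :=
  2^-1 * \sum_l invmx (metric_in c h p) k l *
    ('D_'e_i (fun q => metric_in c h q j l) p
     + 'D_'e_j (fun q => metric_in c h q i l) p
     - 'D_'e_l (fun q => metric_in c h q i j) p).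

(* Levi-Civita connection: (nabla_v Y)(x) for v in T_x M and Y a vector field
   defined near x. *)
Definition levi_civita (h : M -> 'M[R]_n) (x : M) (v : 'rV[R]_n)
    (Y : M -> 'rV[R]_n) : 'rV[R]_n :=
  let c := chart_at x in
  let p := coor c x in
  \row_k ('D_v (fun q => vec_in c Y q 0 k) p
          + \sum_i \sum_j christoffel h c k i j p * v 0 i * Y x 0 j).

(* Sign convention: positive on round spheres. *)
Definition Ric (h : M -> 'M[R]_n) (x : M) : 'M[R]_n :=
  let c := chart_at x in
  let p := coor c x in
  let G := christoffel h c in
  \matrix_(i, j)
    (\sum_k ('D_'e_k (G k i j) p - 'D_'e_j (G k i k) p)
     + \sum_k \sum_l (G k k l p * G l i j p - G k j l p * G l i k p)).

Definition scalar_curvature (h : M -> 'M[R]_n) (x : M) : R :=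
  \tr (invmx (h x) *m Ric h x).

Definition einstein (h : M -> 'M[R]_n) (lambda : R) : Prop :=
  forall x, Ric h x = (2 * (n%:R - 1) * lambda) *: h x.

Definition Jcurv (h : M -> 'M[R]_n) (x : M) : R :=
  scalar_curvature h x / (2 * (n%:R - 1)).

Definition conf_factor (h : M -> 'M[R]_n) (r : R) (x : M) : R :=
  1 - Jcurv h x / (2 * n%:R) * r ^+ 2.

Definition metric_r (h : M -> 'M[R]_n) (r : R) (x : M) : 'M[R]_n :=
  conf_factor h r x ^+ 2 *: h x.

(* As a field of endomorphisms of TM, acting on row vectors by v |-> v *m f. *)
Definition frame_map (h : M -> 'M[R]_n) (r : R) (x : M) : 'M[R]_n :=
  ((conf_factor h r x)^-1)%:M.

End Geometry.

Section Spin.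
Variables (R : realType) (n : nat) (M : manifold R n) (N : nat).
Variables (p : nat) (gam : 'I_n -> 'M[R[i]]_N).

Definition clifford_relations : Prop :=
  forall i j, gam i *m gam j + gam j *m gam i
              = (if i == j then - 2 * (eps R p i)%:C else 0)%:M.

Definition cliff (v : 'rV[R]_n) : 'M[R[i]]_N :=
  \sum_i (v 0 i)%:C *: gam i.

(* The image in GL_N(C) of Spin(p,q) = { v_1 ... v_2m : <v_i, v_i> = +-1 };
   the complex spinor representation is faithful on the even part of the
   Clifford algebra, hence on Spin(p,q). *)
Definition in_spin (g : 'M[R[i]]_N) : Prop :=
  exists s : seq 'rV[R]_n,
    [/\ ~~ odd (size s),
        forall v, v \in s -> `|\sum_i eps R p i * v 0 i ^+ 2| = 1
      & g = foldr (fun v u => cliff v *m u) 1%:M s].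

(* A spin structure presented by local sections over a cover: sframe a is the
   frame (s_1, ..., s_n) underlying the a-th section (as the rows of a matrix,
   in [chart_at x] coordinates), and the b-th section is the a-th one times
   strans a b. *)
Record spin_data := SpinData {
  sidx : Type;
  sdom : sidx -> set M;
  sframe : sidx -> M -> 'M[R]_n;
  strans : sidx -> sidx -> M -> 'M[R[i]]_N
}.

Definition spin_structure (h : M -> 'M[R]_n) (Q : spin_data) : Prop :=
  [/\ [/\ forall a : sidx Q, open (sdom a)
        & forall x, exists a : sidx Q, sdom a x],
      [/\ forall (a : sidx Q) (i : 'I_n),
            smooth_vector_field_on (sdom a) (fun x => row i (sframe a x))
        & forall (a : sidx Q) x, sdom a x ->
            sframe a x *m h x *m (sframe a x)^T = epsmx R n p],
      [/\ forall (a b : sidx Q) x, sdom a x -> sdom b x -> in_spin (strans a b x),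
          forall (a b : sidx Q) (i j : 'I_N),
            smooth_on (sdom a `&` sdom b)
                      (fun x => complex.Re (strans a b x i j)) /\
            smooth_on (sdom a `&` sdom b)
                      (fun x => complex.Im (strans a b x i j))
        & forall (a b c : sidx Q) x, sdom a x -> sdom b x -> sdom c x ->
            strans a b x *m strans b c x = strans a c x]
      (* g e_j g^-1 = \sum_i A j i e_i, where s^b_j = \sum_i A j i s^a_i *)
    & forall (a b : sidx Q) x, sdom a x -> sdom b x ->
        exists2 A : 'M[R]_n, sframe b x = A *m sframe a x
          & forall j, strans a b x *m gam j = cliff (row j A) *m strans a b x].

(* The fibre over x of the associated bundle consists of the classes
   [a-th section at x, v_a], with v_a = strans a b x *m v_b; the values
   psi a x with x outside sdom a are irrelevant. *)
Definition spinor (Q : spin_data) := sidx Q -> M -> 'cV[R[i]]_N.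

Definition spinor_field (Q : spin_data) (psi : spinor Q) : Prop :=
  (forall a b x, sdom a x -> sdom b x ->
     psi a x = strans a b x *m psi b x) /\
  (forall (a : sidx Q) (k : 'I_N),
     smooth_on (sdom a) (fun x => complex.Re (psi a x k 0)) /\
     smooth_on (sdom a) (fun x => complex.Im (psi a x k 0))).

(* The coordinates of u in the frame s^a are u *m invmx (sframe a x). *)
Definition clifford_mul (Q : spin_data) (a : sidx Q) (x : M)
    (u : 'rV[R]_n) (phi : 'cV[R[i]]_N) : 'cV[R[i]]_N :=
  cliff (u *m invmx (sframe a x)) *m phi.

Definition spinor_derive (Q : spin_data) (psi : spinor Q) (a : sidx Q) (x : M)
    (v : 'rV[R]_n) : 'cV[R[i]]_N :=
  let c := chart_at x in
  \col_k ('D_v (fun q => complex.Re (psi a (point c q) k 0)) (coor c x)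
          +i* 'D_v (fun q => complex.Im (psi a (point c q) k 0)) (coor c x)).

(* nabla_v psi = v(psi)
     + 1/2 \sum_(i < j) eps_i eps_j h(nabla_v s_i, s_j) s_i . s_j . psi *)
Definition spin_connection (h : M -> 'M[R]_n) (Q : spin_data) (psi : spinor Q)
    (a : sidx Q) (x : M) (v : 'rV[R]_n) : 'cV[R[i]]_N :=
  let s i := fun y => row i (sframe a y) in
  spinor_derive psi a x v
  + \sum_(i < n) \sum_(j < n | (i < j)%N)
      (2^-1 * eps R p i * eps R p j
       * inner h x (levi_civita h x v (s i)) (s j x))%:C
        *: clifford_mul a x (s i x) (clifford_mul a x (s j x) (psi a x)).

Definition dirac_op (h : M -> 'M[R]_n) (Q : spin_data) (psi : spinor Q) :
    spinor Q := fun a x =>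
  \sum_i (eps R p i)%:C *:
    clifford_mul a x (row i (sframe a x))
      (spin_connection h psi a x (row i (sframe a x))).

(* The spin structure whose sections lie over the frames f s^a; the spin lift
   of f maps the a-th section of Q to the a-th section of transport f Q. *)
Definition transport (f : M -> 'M[R]_n) (Q : spin_data) : spin_data :=
  @SpinData (sidx Q) (@sdom Q) (fun a x => sframe a x *m f x) (@strans Q).

(* beta [q, v] = [f q, v]: in terms of local representatives, the identity. *)
Definition beta (f : M -> 'M[R]_n) (Q : spin_data) (psi : spinor Q) :
  spinor (transport f Q) := psi.

Definition beta_inv (f : M -> 'M[R]_n) (Q : spin_data)
  (psi : spinor (transport f Q)) : spinor Q := psi.

Definition pulled_dirac (h : M -> 'M[R]_n) (Q : spin_data) (r : R)
    (psi : spinor Q) : spinor Q :=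
  beta_inv (dirac_op (metric_r h r) (@beta (frame_map h r) Q psi)).

End Spin.

Section IteratedDerivative.
Variables (R : realType) (N : nat).

Definition derivative_on (I : set R) (F G : R -> 'cV[R[i]]_N) : Prop :=
  forall r, I r -> forall k,
    (fun s => (s - r)^-1 * (complex.Re (F s k 0) - complex.Re (F r k 0)))
      @ within I r^' --> complex.Re (G r k 0) /\
    (fun s => (s - r)^-1 * (complex.Im (F s k 0) - complex.Im (F r k 0)))
      @ within I r^' --> complex.Im (G r k 0).

(* F is m times differentiable on I (relative to I, so one-sided at end points)
   and its m-th derivative at r0 is w. *)
Definition nth_derivative_at (I : set R) (F : R -> 'cV[R[i]]_N) (m : nat)
    (r0 : R) (w : 'cV[R[i]]_N) : Prop :=
  exists G : nat -> R -> 'cV[R[i]]_N,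
    [/\ forall r, I r -> G 0%N r = F r,
        forall j, (j < m)%N -> derivative_on I (G j) (G j.+1)
      & G m r0 = w].

End IteratedDerivative.

(* Main.v *)
(* For an Einstein metric J is constant on M, so h_r = c^2 h with the constant
   c = 1 - (J/2n) r^2.  The Levi-Civita connection does not see constant
   factors, and the frames c^-1 s_i contribute c^-1 to every direction of
   differentiation; hence the pulled back Dirac operator is c^-1 D^h, and what
   remains is to differentiate r |-> (1 - k r^2)^-1. *)
Require Import Defs.
From HB Require Import structures.
From mathcomp Require Import all_boot all_order all_algebra.
From mathcomp Require Import complex.
From mathcomp Require Import all_classical all_reals all_analysis.
From mathcomp Require Import ring.
Import Order.TTheory GRing.Theory Num.Theory.
Import numFieldNormedType.Exports.
Local Open Scope classical_set_scope.
Local Open Scope complex_scope.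
Local Open Scope ring_scope.

(** * Directional derivatives under scaling *)

(* The junk value of [lim] at a divergent function is 0 in [R], so scaling
   commutes with [lim], and hence with ['D_v], even without convergence. *)
Lemma lim_scale (R : realType) (T : Type) (F : set_system T)
    (FF : ProperFilter F) (b : R) (f : T -> R) : b != 0 ->
  lim ((fun t => b * f t) @ F) = b * lim (f @ F).
Proof.
move=> b0; have [fF|fF] := pselect (cvg (f @ F)).
  by apply/cvg_lim => //; exact: cvgMl_tmp.
rewrite (dvgP fF) mulr0 dvgP// => bfF; apply: fF.
rewrite (_ : f = fun t => b^-1 * (b * f t)); last first.
  by apply/funext => t; rewrite mulKf.
exact: is_cvgMl_tmp.
Qed.

(** Continuity and injectivity of t |-> b t give one inclusion; the same for b^-1 gives the
    other. *)
Lemma scale_dnbhs0 (R : realType) (b : R) : b != 0 ->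
  (fun t => b * t) @ (0 : R)^' = (0 : R)^'.
Proof.
have sub (d : R) : d != 0 -> (fun t => d * t) @ (0 : R)^' --> (0 : R)^'.
  move=> d0; rewrite -{2}(mulr0 d); apply: continuous_injective_withinNx.
    exact: mulrl_continuous.
  by move=> y /(mulfI d0).
move=> b0; apply/seteqP; split => A /=; last first.
  by move=> hA; exact: (sub b b0 A hA).
move=> bA; have := sub b^-1 (invr_neq0 b0) _ bA; rewrite /= /nbhs/=.
by congr (_ _); apply/funext => t /=; rewrite mulVKf.
Qed.

Lemma derive_scale (R : realType) (V : normedModType R) (b : R)
    (f : V -> R) (p v : V) : b != 0 ->
  'D_v (fun q => b * f q) p = b * 'D_v f p.
Proof.
move=> b0; rewrite /derive -lim_scale//.
apply: (congr1 (fun g : R -> R => lim (g @ (0 : R)^'))).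
by apply/funext => t /=; rewrite -mulrBr /GRing.scale/= mulrCA.
Qed.

(** The substitution t -> b t turns the difference quotient along v into b^-1 times the one along b
    v, so divergent quotients are covered too. *)
Lemma derive_scalel (R : realType) (V : normedModType R) (b : R)
    (f : V -> R) (p v : V) : b != 0 ->
  'D_(b *: v) f p = b * 'D_v f p.
Proof.
move=> b0; rewrite /derive -lim_scale//.
rewrite -[in RHS](@scale_dnbhs0 R b b0).
apply: (congr1 (fun g : R -> R => lim (g @ (0 : R)^'))).
apply/funext => t /=; rewrite scalerA (mulrC t b) /GRing.scale/= invfM.
by rewrite !mulrA divff// mul1r.
Qed.

(** The remainder of f against the identity vanishes near p, and the differential is unique.
    Equality near p is what charts offer: [coor c \o point c] is the identity on the open set of
    coordinates of [dom c]. *)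
Lemma jacobian_near_id (R : realType) (n : nat) (f : 'rV[R]_n -> 'rV[R]_n)
    (p : 'rV[R]_n) : (\near p, f p = p) -> jacobian f p = 1%:M.
Proof.
move=> fid; rewrite /jacobian.
have -> : ('d f p : 'rV[R]_n -> 'rV[R]_n) = idfun.
  apply: (@diff_unique R _ _ f idfun); first by move=> x; exact: cvg_id.
  apply/eqaddoP => e /= e0.
  have : \forall y \near (0 : 'rV[R]_n), f (y + p) = y + p.
    by move: fid; rewrite (near_shift 0)/= subr0.
  apply: filterS => y /= fy; rewrite !fctE/= fy (nbhs_singleton fid).
  by rewrite [p + y]addrC subrr normr0 mulr_ge0// ltW.
by apply/row_matrixP => i; rewrite rowE mul_rV_lin1 row1.
Qed.

(** * Iterated derivatives of (1 - k r^2)^-1 *)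

(* The m-th derivative at r of f(r) = (1 - k r^2)^-1: by Leibniz' rule applied
   to (1 - k r^2) f = 1,
   (1 - k r^2) f^(m) = 2 k m r f^(m-1) + k m (m-1) f^(m-2). *)
Fixpoint inv_quad_deriv {R : realType} (k : R) (m : nat) (r : R) : R :=
  if m is m1.+1 then
    (2 * k * m%:R * r * inv_quad_deriv k m1 r
     + (if m1 is m2.+1 then k * m%:R * m1%:R * inv_quad_deriv k m2 r else 0))
    / (1 - k * r ^+ 2)
  else (1 - k * r ^+ 2)^-1.

Lemma is_derive_quad (R : realType) (k r : R) :
  is_derive r (1 : R) (fun t : R => 1 - k * t ^+ 2) (- (2 * k * r)).
Proof.
have := is_deriveB (is_derive_cst (1 : R) r 1)
  (is_deriveZ k (is_deriveX 2 (is_derive_id r (1 : R)))) => /is_derive_eq.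
by apply; rewrite /GRing.scale/=; ring.
Qed.

Lemma inv_quad_derivSS (R : realType) (k : R) (m : nat) (r : R) :
  inv_quad_deriv k m.+2 r =
  (2 * k * m.+2%:R * r * inv_quad_deriv k m.+1 r
   + k * m.+2%:R * m.+1%:R * inv_quad_deriv k m r) / (1 - k * r ^+ 2).
Proof. by []. Qed.

(** Write F_m for the m-th function and c for 1 - k r^2. Differentiating the recursion for F_(m+2)
    gives c F_(m+2)' = (2k(m+2) + 2k) r F_(m+2) + (2k(m+2) + k(m+2)(m+1)) F_(m+1), which is the
    recursion for F_(m+3). *)
Lemma inv_quad_derivP (R : realType) (k : R) (m : nat) (r : R) :
  1 - k * r ^+ 2 != 0 ->
  is_derive r (1 : R) (inv_quad_deriv k m) (inv_quad_deriv k m.+1 r).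
Proof.
move=> r0; have dc := is_derive_quad R k r.
have dV : is_derive r (1 : R) (fun t : R => (1 - k * t ^+ 2)^-1)
    (2 * k * r / (1 - k * r ^+ 2) ^+ 2).
  by apply: is_derive_eq; rewrite /GRing.scale/=; field.
have step (u : R -> R) (du : R) : is_derive r (1 : R) u du ->
    is_derive r (1 : R) (fun t => u t / (1 - k * t ^+ 2))
      ((du + 2 * k * r * (u r / (1 - k * r ^+ 2))) / (1 - k * r ^+ 2)).
  move=> hu; have := is_deriveM hu dV => /is_derive_eq; apply.
  by rewrite /GRing.scale/=; field.
have dlin (a : R) (u : R -> R) (du : R) : is_derive r (1 : R) u du ->
    is_derive r (1 : R) (fun t => a * t * u t) (a * u r + a * r * du).
  move=> hu.
  have := is_deriveM (is_deriveZ a (is_derive_id r (1 : R))) hu.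
  move=> /is_derive_eq; apply.
  by rewrite /= -[a *: r]/(a * r) /GRing.scale/=; ring.
have dscale (a : R) (u : R -> R) (du : R) : is_derive r (1 : R) u du ->
    is_derive r (1 : R) (fun t => a * u t) (a * du).
  by move=> hu; exact: is_deriveZ.
elim/ltn_ind: m => -[|[|m]] IH.
- by apply: (is_derive_eq dV); rewrite /= addr0 !mulr1; field.
- have h0 := IH 0%N isT.
  have := step _ _ (is_deriveD (dlin (2 * k * 1) _ _ h0)
             (is_derive_cst (0 : R) r 1)).
  by move=> /is_derive_eq; apply; rewrite !fctE /=; field.
- have h0 := IH m (ltnW (ltnSn _)).
  have h1 := IH m.+1 (ltnSn _).
  have := step _ _ (is_deriveD (dlin (2 * k * m.+2%:R) _ _ h1)
             (dscale (k * m.+2%:R * m.+1%:R) _ _ h0)).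
  move=> /is_derive_eq; apply.
  rewrite [in RHS]inv_quad_derivSS.
  (* The quotient left by [step] is F_(m+2)(r); spelled out everywhere in this form, it lets [ring]
     compare the numerators. *)
  have <- : ((fun t => 2 * k * m.+2%:R * t * inv_quad_deriv k m.+1 t)
       + (fun t => k * m.+2%:R * m.+1%:R * inv_quad_deriv k m t)) r
       / (1 - k * r ^+ 2) = inv_quad_deriv k m.+2 r by [].
  by congr (_ / _); rewrite -!natr1; ring.
Qed.

(** At r = 0 the recursion becomes F_(m+2)(0) = k (m+2)(m+1) F_m(0); F_0(0) = 1 starts the even
    orders, F_1(0) = 0 the odd ones. *)
Lemma inv_quad_deriv0_even (R : realType) (k : R) (l : nat) :
  inv_quad_deriv k (2 * l) 0 = ((2 * l)`!)%:R * k ^+ l.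
Proof.
elim: l => [|l IH]; first by rewrite /= expr0n mulr0 subr0 invr1 mulr1.
rewrite mulnS add2n inv_quad_derivSS IH mulr0 mul0r add0r expr0n/=.
rewrite mulr0 subr0 divr1.
by rewrite !factS !natrM exprS; ring.
Qed.

Lemma inv_quad_deriv0_odd (R : realType) (k : R) (l : nat) :
  inv_quad_deriv k (2 * l).+1 0 = 0.
Proof.
elim: l => [|l IH]; first by rewrite /= mulr0 mul0r add0r mul0r.
rewrite mulnS add2n inv_quad_derivSS.
by rewrite IH !mulr0 mul0r addr0 mul0r.
Qed.

(** A two-sided derivative restricts to I, and a real factor acts on the real and imaginary parts of
    w separately. *)
Lemma derivative_on_scale (R : realType) (N : nat) (I : set R) (f g : R -> R)
    (w : 'cV[R[i]]_N) : (forall r, I r -> is_derive r (1 : R) f (g r)) ->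
  derivative_on I (fun r => (f r)%:C *: w) (fun r => (g r)%:C *: w).
Proof.
move=> fg r Ir k.
have fr : (fun s => (s - r)^-1 * (f s - f r)) @ within I r^' --> g r.
  (* Caratheodory's form gives a function u, continuous at r, that equals the difference quotient
     away from r. *)
  have /is_derive1_caratheodory [u [fu u_cont <-]] := fg r Ir.
  apply: (@cvg_trans _ (u @ within I r^')).
    apply: near_eq_cvg; apply: cvg_within.
    apply: filterS (nbhs_dnbhs_neq r) => s sr.
    by rewrite fu mulrC mulfK// subr_eq0.
  apply: cvg_trans u_cont; apply: cvg_app.
  by apply: cvg_trans (@nbhs_dnbhs _ r); exact: cvg_within.
have ReM (b : R) : complex.Re ((b%:C *: w) k 0) = b * complex.Re (w k 0).
  by rewrite mxE; case: (w k 0) => u v /=; rewrite mul0r subr0.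
have ImM (b : R) : complex.Im ((b%:C *: w) k 0) = b * complex.Im (w k 0).
  by rewrite mxE; case: (w k 0) => u v /=; rewrite mul0r addr0.
split.
  rewrite (ReM (g r)); under eq_fun do rewrite !ReM -mulrBl mulrA.
  exact: cvgMr_tmp.
rewrite (ImM (g r)); under eq_fun do rewrite !ImM -mulrBl mulrA.
exact: cvgMr_tmp.
Qed.

(** * Invertible Gram and frame matrices *)

Lemma epsmx_unit (R : realType) (n p : nat) : epsmx R n p \in unitmx.
Proof.
rewrite unitmxE det_diag unitfE; apply/prodf_neq0 => i _.
by rewrite mxE /eps; case: ifP; rewrite ?oppr_eq0 oner_neq0.
Qed.

(** Provides the inverses of the Gram matrices [h x] and of the frame matrices [sframe a x]. *)
Lemma congr_epsmx_unit (R : realType) (n p : nat) (P A : 'M[R]_n) :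
  P *m A *m P^T = epsmx R n p -> P \in unitmx /\ A \in unitmx.
Proof.
move=> PA; have := epsmx_unit R n p; rewrite -PA !unitmx_mul unitmx_tr.
by case/andP => /andP[-> ->].
Qed.

Lemma scaled_invmx (R : comUnitRingType) (n : nat) (b : R) (A : 'M[R]_n) :
  b \is a GRing.unit -> A \in unitmx -> invmx (b *: A) = b^-1 *: invmx A.
Proof. by move=> bU AU; rewrite invmxZ// unitmxZ. Qed.

(** * The Levi-Civita connection under constant scaling *)

Section Scaling.
Context {R : realType} {n : nat} {M : manifold R n}.
Implicit Types (h : M -> 'M[R]_n) (b : R).

Lemma change_refl (c : chart M) (x : M) : dom c x -> change c c x = 1%:M.
Proof.
move=> cx; apply: jacobian_near_id.
have : nbhs (coor c x) (coor c @` dom c).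
  by apply: open_nbhs_nbhs; split; [exact: coor_open | exists x].
by apply: filterS => _ [y cy <-] /=; rewrite coorK.
Qed.

(** Makes the component matrix at the base point invertible as soon as [h x] is. *)
Lemma metric_in_chart_at h (x : M) :
  metric_in (chart_at x) h (coor (chart_at x) x) = h x.
Proof.
have cx := dom_chart_at x.
by rewrite /metric_in coorK// change_refl// trmx1 mulmx1 mul1mx.
Qed.

(** The inverse metric contributes b^-1, the derivatives of the components contribute b. *)
Lemma christoffel_scale h b (x : M) (k i j : 'I_n) : b != 0 ->
  h x \in unitmx ->
  christoffel (fun y => b *: h y) (chart_at x) k i j (coor (chart_at x) x)
  = christoffel h (chart_at x) k i j (coor (chart_at x) x).
Proof.
move=> b0 hU; rewrite /christoffel !metric_in_chart_at.
rewrite scaled_invmx ?unitfE//; congr (_ * _); apply: eq_bigr => l _.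
set c := chart_at x; set y := coor c x.
have E (u v w : 'I_n) :
    'D_'e_u (fun q => metric_in c (fun z => b *: h z) q v w) y
    = b * 'D_'e_u (fun q => metric_in c h q v w) y.
  rewrite -derive_scale//; apply: (congr1 (fun f => 'D_'e_u f _)).
  by apply/funext => q; rewrite /metric_in -scalemxAr -scalemxAl mxE.
by rewrite !E mxE; field.
Qed.

(** One factor d comes from the direction, the other from the constant multiple of the field; b
    drops out with the Christoffel symbols. *)
Lemma levi_civita_scale h b d (x : M) (v : 'rV[R]_n) (Y : M -> 'rV[R]_n) :
  b != 0 -> d != 0 -> h x \in unitmx ->
  levi_civita (fun y => b *: h y) x (d *: v) (fun y => d *: Y y)
  = d ^+ 2 *: levi_civita h x v Y.
Proof.
move=> b0 d0 hU; apply/rowP => k; rewrite !mxE mulrDr; congr (_ + _).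
  rewrite derive_scalel// expr2 -mulrA; congr (_ * _); rewrite -derive_scale//.
  apply: (congr1 (fun f => 'D_v f _)).
  by apply/funext => q; rewrite /vec_in -scalemxAl mxE.
rewrite mulr_sumr; apply: eq_bigr => i _; rewrite mulr_sumr.
by apply: eq_bigr => j _; rewrite christoffel_scale// !mxE; ring.
Qed.

Lemma inner_scale h b d d' (x : M) (v w : 'rV[R]_n) :
  inner (fun y => b *: h y) x (d *: v) (d' *: w) = d * b * d' * inner h x v w.
Proof.
rewrite /inner [(d' *: w)^T]linearZ /= -!(scalemxAl, scalemxAr) !scalerA mxE.
by congr (_ * _); ring.
Qed.

End Scaling.

(** * The Dirac operator under constant scaling *)

Section DiracScaling.
Context {R : realType} {n : nat} {M : manifold R n} {N : nat}.
Variables (p : nat) (gam : 'I_n -> 'M[R[i]]_N).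
Implicit Types (h : M -> 'M[R]_n) (b : R) (Q : spin_data M N).

(** Clifford multiplication by corresponding frame vectors is the same for both structures; the
    covariant derivative along b^-1 s_i supplies the single factor b^-1. *)
Lemma dirac_op_scale h b Q (psi : spinor Q) (a : sidx Q) (x : M) : b != 0 ->
  h x \in unitmx -> sframe a x \in unitmx ->
  dirac_op p gam (fun y => b ^+ 2 *: h y)
    (psi : spinor (transport (fun=> (b^-1)%:M) Q)) a x
  = (b^-1)%:C *: dirac_op p gam h psi a x.
Proof.
move=> b0 hU sU; set f : M -> 'M[R]_n := fun=> (b^-1)%:M.
have b'0 : b^-1 != 0 by rewrite invr_eq0.
have frE : @sframe _ _ _ _ (transport f Q) a = fun y => b^-1 *: sframe a y.
  by apply/funext => y; rewrite /= /f mul_mx_scalar.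
have rowE i y : row i (b^-1 *: sframe a y) = b^-1 *: row i (sframe a y).
  exact: linearZ.
(* In the frame b^-1 s, the vector b^-1 u has the coordinates that u has in s. *)
have cliffE u phi :
  clifford_mul gam (a : sidx (transport f Q)) x (b^-1 *: u) phi
  = clifford_mul gam a x u phi.
  rewrite /clifford_mul frE scaled_invmx ?unitfE// invrK.
  by rewrite -scalemxAl -scalemxAr scalerA mulVf// scale1r.
have connE v :
  spin_connection p gam (fun y => b ^+ 2 *: h y) (psi : spinor (transport f Q))
    a x (b^-1 *: v) = (b^-1)%:C *: spin_connection p gam h psi a x v.
  rewrite /spin_connection scalerDr; congr (_ + _).
    apply/colP => k; rewrite !mxE !derive_scalel//.
    by apply/eqP; rewrite eq_complex /= !mul0r subr0 addr0 !eqxx.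
  rewrite scaler_sumr; apply: eq_bigr => i _; rewrite scaler_sumr.
  apply: eq_bigr => j _; rewrite frE !rowE !cliffE.
  have -> : (fun y => row i (b^-1 *: sframe a y)) =
            (fun y => b^-1 *: row i (sframe a y)).
    by apply/funext => y; rewrite rowE.
  (* The coefficient scales by b^-2 (direction and s_i) times b^2 (metric) times b^-1 (s_j), hence
     by b^-1, like the derivative term. *)
  rewrite levi_civita_scale ?expf_neq0// scalerA; congr (_ *: _).
  rewrite -rmorphM/=; congr (_%:C).
  by rewrite inner_scale; field.
rewrite /dirac_op scaler_sumr; apply: eq_bigr => i _.
rewrite frE rowE cliffE connE /clifford_mul.
by rewrite -scalemxAr !scalerA mulrC.
Qed.

End DiracScaling.

(** * Einstein metrics and the Taylor coefficients *)

(** The scalar curvature is the trace of 2(n-1) lambda Id, hence 2n(n-1) lambda; so J is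
    constant. *)
Lemma einstein_Jcurv (R : realType) (n : nat) (M : manifold R n)
    (h : M -> 'M[R]_n) (lambda : R) (x : M) : (1 < n)%N -> einstein h lambda ->
  h x \in unitmx -> Jcurv h x = n%:R * lambda.
Proof.
move=> n1 hE hU; rewrite /Jcurv /scalar_curvature hE -scalemxAr mulVmx//.
rewrite mxtraceZ mxtrace1.
have : (n%:R - 1 : R) != 0 by rewrite subr_eq0 pnatr_eq1 gtn_eqF.
by move=> n0; field.
Qed.

Theorem theorem3p5 (R : realType) (p q n : nat) (npq : n = (p + q)%N)
    (n_ge3 : (3 <= n)%N) (M : manifold R n)
    (h : M -> 'M[R]_n) (h_metric : semi_riemannian_metric p h)
    (lambda : R) (h_einstein : einstein h lambda)
    (gam : 'I_n -> 'M[R[i]]_(2 ^ n./2)) (gam_cliff : clifford_relations p gam)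
    (Q : spin_data M (2 ^ n./2)) (Q_spin : spin_structure p gam h Q)
    (e : R) (e_gt0 : 0 < e)
    (e_small : forall (r : R) (x : M), 0 <= r < e -> 0 < conf_factor h r x)
    (psi : spinor Q) (psi_field : spinor_field psi)
    (l : nat) (a : sidx Q) (x : M) (ax : sdom a x) :
  nth_derivative_at [set r | 0 <= r < e]
    (fun r => pulled_dirac p gam h r psi a x) (2 * l)%N 0
    ((((2 * l)%N`!)%:R * (Jcurv h x / (2 * n%:R)) ^+ l)%:C *: dirac_op p gam h psi a x)
  /\
  nth_derivative_at [set r | 0 <= r < e]
    (fun r => pulled_dirac p gam h r psi a x) (2 * l).+1%N 0 0.
Proof.
have hU y : h y \in unitmx.
  by have [_ /(_ y)[P _ /congr_epsmx_unit[]]] := h_metric.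
(* J is compared at all points because the connection differentiates near x: metric and frame map
   must be constant multiples as functions on M. *)
have JE y : Jcurv h y = Jcurv h x.
  by rewrite !(einstein_Jcurv _ _ _ _ _ _ (ltnW n_ge3) h_einstein).
have sU : sframe a x \in unitmx.
  by have [_ [_ /(_ a x ax)/congr_epsmx_unit[]]] := Q_spin.
pose k := Jcurv h x / (2 * n%:R).
have c0 r : 0 <= r < e -> 1 - k * r ^+ 2 != 0.
  by move=> /(e_small r x) /gt_eqF ->.
(* One sequence is the witness for both parities: the derivatives of (1 - k r^2)^-1 times D^h
   psi. *)
pose G m r := (inv_quad_deriv k m r)%:C *: dirac_op p gam h psi a x.
have G0 r : 0 <= r < e -> G 0%N r = pulled_dirac p gam h r psi a x.
  move=> /c0 r0; rewrite /G /pulled_dirac /beta_inv /beta.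
  have -> : frame_map h r = fun=> ((1 - k * r ^+ 2)^-1)%:M.
    by apply/funext => y; rewrite /frame_map /conf_factor JE.
  have -> : metric_r h r = fun y => (1 - k * r ^+ 2) ^+ 2 *: h y.
    by apply/funext => y; rewrite /metric_r /conf_factor JE.
  exact/esym/dirac_op_scale.
have G' j : derivative_on [set r | 0 <= r < e] (G j) (G j.+1).
  by apply: derivative_on_scale => r /c0; exact: inv_quad_derivP.
split; exists G; split => //.
- by rewrite /G inv_quad_deriv0_even.
- by rewrite /G inv_quad_deriv0_odd scale0r.
Qed.
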